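(* If $0\le p\le1$ and $n\ge1$, then $\widehat T_{n,p}\overset{\mathrm d}{=}T_{n;S_p}$ (equality in distribution of random graphs with vertex set $[n]$).
   Context: $[n]=\{1,\dots,n\}$. For $p\in[0,1]$, $T_{n,p}$ is the random threshold graph on $n$ vertices obtained by starting with a single vertex and adding vertices one by one ($n-1$ additions), each new vertex being, independently of the others, dominating (joined to all previous vertices) with probability $p$ and isolated (joined to no previous vertex) with probability $1-p$. $\widehat T_{n,p}$ is the random graph on $[n]$ obtained by a uniformly random permutation of the vertices (labels) of $T_{n,p}$. For a symmetric increasing set $S\subseteq[0,1]^2$ (symmetric: $(x,y)\in S\iff(y,x)\in S$; increasing: $(x,y)\in S$, $x\le x'\le1$, $y\le y'\le1$ imply $(x',y')\in S$), $T_{n;S}$ is the random graph on $[n]$ obtained by taking i.i.d. $U_1,\dots,U_n$ uniform on $(0,1)$ and joining distinct $i,j$ by an edge iff $(U_i,U_j)\in S$. For $0<p<1$, $\mu_p$ is the probability measure on $[0,1]$ with constant density $(1-p)/p$ on $(0,p)$ and $p/(1-p)$ on $(p,1)$; $\mu_0$ is a point mass at $0$ and $\mu_1$ is a point mass at $1$. $S_p:=S_{\mu_p}$, where for a probability measure $\mu$ on $[0,1]$, $S_\mu:=\{(x,y)\in[0,1]^2:x\ge\mu([0,1-y))\}$. (For $0<p<1$, $S_p$ is the closed quadrilateral with vertices $(0,1)$, $(1-p,1-p)$, $(1,0)$, $(1,1)$; $S_0$ consists of the upper and right edges of $[0,1]^2$ only, and $S_1=[0,1]^2$.) *)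

(* Defs.v *)
From HB Require Import structures.
From mathcomp Require Import all_boot all_order all_algebra all_fingroup.
From mathcomp Require Import all_classical all_reals all_analysis.
From mathcomp Require Import measurable_realfun.
Import Order.TTheory GRing.Theory Num.Theory.
Import numFieldNormedType.Exports.

Set Implicit Arguments.
Unset Strict Implicit.
Unset Printing Implicit Defensive.

Local Open Scope ring_scope.

(* The vertex set [n] = {1, .., n} is rendered as 'I_n = {0, .., n-1}. *)
Section Graphs.
Local Open Scope nat_scope.
Local Open Scope set_scope.
Variable n : nat.

(* A simple graph on 'I_n is its set of edges, a set of 2-element subsets. *)
Definition is_graph (E : {set {set 'I_n}}) : bool := [forall e in E, #|e| == 2].

Definition graph := {E : {set {set 'I_n}} | is_graph E}.

Definition edges_of (r : rel 'I_n) : {set {set 'I_n}} :=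
  [set e : {set 'I_n} |
    [exists i, exists j, [&& i != j, r i j & e == [set i; j]]]].

Fact edges_of_proof (r : rel 'I_n) : is_graph (edges_of r).
Proof.
apply/forall_inP => e; rewrite inE => /existsP[i /existsP[j]].
by case/and3P=> ij _ /eqP ->; rewrite cards2 ij.
Qed.

(* {i, j} is an edge iff i <> j and r holds for (i, j) or for (j, i). *)
Definition graph_of (r : rel 'I_n) : graph := @exist _ is_graph _ (edges_of_proof r).

Fact relabel_proof (s : {perm 'I_n}) (G : graph) :
  is_graph [set s @: e | e : {set 'I_n} in val G].
Proof.
apply/forall_inP => _ /imsetP[e eG ->].
rewrite card_imset; last exact: perm_inj.
by have /forall_inP := valP G; apply.
Qed.

(* The vertex i of G receives the label s i. *)
Definition relabel (s : {perm 'I_n}) (G : graph) : graph :=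
  @exist _ is_graph _ (relabel_proof s G).

(* Vertices are numbered by order of insertion. The addition k : 'I_n.-1 (one
   of n - 1) inserts the vertex k.+1; it is dominating when b k, and is then
   joined to the vertices 0, .., k. *)
Definition threshold_graph (b : 'I_n.-1 -> bool) : graph :=
  graph_of (fun i j : 'I_n =>
    [exists k : 'I_n.-1, [&& b k, i == k.+1 :> nat & j <= k]]).

Definition graph_of_set (R : realType) (S : set (R * R)) (u : 'I_n -> R) :
  graph := graph_of (fun i j => (u i, u j) \in S).

HB.instance Definition _ := Finite.on graph.
HB.instance Definition _ := isPointed.Build graph (graph_of (fun _ _ => false)).

End Graphs.

Local Open Scope classical_set_scope.

(* Graphs and permutations carry the discrete sigma-algebra. *)
HB.instance Definition _ (n : nat) := @isMeasurable.Build default_measure_display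
  (graph n) discrete_measurable discrete_measurable0
  discrete_measurableC discrete_measurableU.

HB.instance Definition _ (T : finType) := isPointed.Build (perm_type T) 1%g.
HB.instance Definition _ (T : finType) :=
  @isMeasurable.Build default_measure_display (perm_type T) discrete_measurable
  discrete_measurable0 discrete_measurableC discrete_measurableU.

Section Probability.
Local Open Scope ereal_scope.
Context d (T : measurableType d) (R : realType) (P : probability T R).

Definition has_law d' (E : measurableType d') (X : {RV P >-> E})
    (mu : set E -> \bar R) : Prop :=
  forall A, measurable A -> distribution P X A = mu A.

Definition mutually_independent d' (E : measurableType d') (I : finType)
    (X : I -> {RV P >-> E}) : Prop :=
  forall (J : {set I}) (A : I -> set E), (forall i, measurable (A i)) ->
    P (\bigcap_(i in [set` J]) (X i @^-1` A i)) =
    \prod_(i in J) P (X i @^-1` A i).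

(* Y is independent of the family X taken as a whole: the events below are a
   pi-system that generates the sigma-algebra of the family. *)
Definition independent_of_family d' (F : measurableType d') d'' (E : measurableType d'')
    (I : finType) (Y : {RV P >-> F}) (X : I -> {RV P >-> E}) : Prop :=
  forall (C : set F) (A : I -> set E),
    measurable C -> (forall i, measurable (A i)) ->
    P (Y @^-1` C `&` \bigcap_i (X i @^-1` A i)) =
    P (Y @^-1` C) * P (\bigcap_i (X i @^-1` A i)).

Definition uniform_perm (n : nat) (s : {RV P >-> {perm 'I_n}}) : Prop :=
  forall t : {perm 'I_n}, P (s @^-1` [set t]) = ((n`!%:R)^-1 : R)%:E.

(* b k tells whether the k-th addition is dominating. *)
Definition threshold_additions (p : R) (n : nat)
    (b : 'I_n.-1 -> {RV P >-> bool}) : Prop :=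
  mutually_independent b /\ (forall k, has_law (b k) (bernoulli_prob p)).

(* The random graph \hat T_{n,p}, where s is the random relabelling. *)
Definition relabelled_threshold_graph (n : nat) (b : 'I_n.-1 -> {RV P >-> bool})
    (s : {RV P >-> {perm 'I_n}}) (w : T) : graph n :=
  relabel (s w) (threshold_graph (fun k => b k w)).

Definition iid_uniform (n : nat) (U : 'I_n -> {RV P >-> R}) : Prop :=
  mutually_independent U /\ (forall i, has_law (U i) (uniform_prob (@ltr01 R))).

(* The random graph T_{n;S}. *)
Definition random_graph_of_set (n : nat) (S : set (R * R))
    (U : 'I_n -> {RV P >-> R}) (w : T) : graph n :=
  graph_of_set S (fun i => U i w).

End Probability.

Definition eq_in_distribution (R : realType)
    d1 (T1 : measurableType d1) (P1 : probability T1 R)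
    d2 (T2 : measurableType d2) (P2 : probability T2 R)
    d' (E : measurableType d') (X : T1 -> E) (Y : T2 -> E) : Prop :=
  [/\ measurable_fun setT X, measurable_fun setT Y &
      forall A, measurable A -> P1 (X @^-1` A) = P2 (Y @^-1` A)].

Section Mu.
Context (R : realType).
Local Notation leb := (@lebesgue_measure R).

Definition mu_density (p x : R) : R :=
  if 0 < x < p then (1 - p) / p
  else if p < x < 1 then p / (1 - p) else 0.

(* Only 0 <= p <= 1 matters; mu is clamped outside so as to be a probability
   for every p. *)
Definition mu (p : R) : set R -> \bar R :=
  if p <= 0 then \d_(0 : R)
  else if 1 <= p then \d_(1 : R)
  else fun A => (\int[leb]_(x in A) (mu_density p x)%:E)%E.

Lemma mu_density_ge0 p x : 0 < p < 1 -> 0 <= mu_density p x.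
Proof.
move=> /andP[p0 p1]; rewrite /mu_density.
have q0 : 0 < 1 - p by rewrite subr_gt0.
by case: ifP => // _; last case: ifP => // _; rewrite divr_ge0// ltW.
Qed.

Lemma measurable_mu_density p : measurable_fun setT (mu_density p).
Proof.
have mI (a c : R) (D : set R) : measurable_fun D (fun x : R => a < x < c).
  by apply: measurable_and => //; apply: measurable_fun_ltr.
rewrite /mu_density; apply: measurable_fun_ifT => //.
by apply: measurable_fun_ifT.
Qed.

Section mu_measure.
Variable p : R.

Let mid : ~~ (p <= 0) -> ~~ (1 <= p) -> 0 < p < 1.
Proof. by rewrite -!ltNge => -> ->. Qed.

Let mu0 : mu p set0 = 0%E.
Proof.
by rewrite /mu; case: ifP => _; last case: ifP => _;
  rewrite ?measure0 ?integral_set0.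
Qed.

Let mu_ge0 A : (0 <= mu p A)%E.
Proof.
rewrite /mu; case: ifPn => [//|p0]; case: ifPn => [//|p1].
by apply: integral_ge0 => x _; rewrite lee_fin mu_density_ge0// mid.
Qed.

Let mu_sigma_additive : semi_sigma_additive (mu p).
Proof.
rewrite /mu; case: ifPn => p0; first exact: measure_semi_sigma_additive.
case: ifPn => p1; first exact: measure_semi_sigma_additive.
have h x : (0 <= (mu_density p x)%:E)%E.
  by rewrite lee_fin mu_density_ge0// mid.
move=> F mF tF mUF; apply: cvg_toP.
  apply: ereal_nondecreasing_is_cvgn => m k mk.
  by apply: lee_sum_nneg_natr => // i _ _; exact: integral_ge0.
rewrite ge0_integral_bigcup//=.
apply: measurable_funTS; apply: measurableT_comp => //.
exact: measurable_mu_density.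
Qed.

HB.instance Definition _ := isMeasure.Build _ _ _ (mu p)
  mu0 mu_ge0 mu_sigma_additive.

Let mu_setT : mu p [set: R] = 1%E.
Proof.
rewrite /mu; case: ifPn => p0; first by rewrite diracT.
case: ifPn => p1; first by rewrite diracT.
have /andP[p_gt0 p_lt1] := mid p0 p1.
have q_gt0 : 0 < 1 - p by rewrite subr_gt0.
have hl : 0 <= (1 - p) / p by rewrite divr_ge0// ltW.
have hr : 0 <= p / (1 - p) by rewrite divr_ge0// ltW.
transitivity (\int[leb]_(x in setT)
   (((1 - p) / p)%:E * (\1_(`]0%R, p[%classic : set R) x)%:E +
    (p / (1 - p))%:E * (\1_(`]p, 1%R[%classic : set R) x)%:E))%E.
  apply: eq_integral => x _; rewrite -!EFinM -EFinD; congr (_%:E).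
  rewrite /mu_density !indicE !mem_setE !in_itv/=.
  case: ifPn => [/andP[x0 xp]|_].
    by rewrite (lt_gtF xp)/= mulr1 mulr0 addr0.
  by case: ifPn => _; rewrite ?mulr1 !mulr0 ?add0r ?addr0.
rewrite ge0_integralD//; first last.
- by apply/measurable_EFinP; apply: measurable_funM.
- by move=> x _; rewrite -EFinM lee_fin mulr_ge0.
- by apply/measurable_EFinP; apply: measurable_funM.
- by move=> x _; rewrite -EFinM lee_fin mulr_ge0.
rewrite !ge0_integralZl//; first last.
- exact/measurable_EFinP.
- exact/measurable_EFinP.
rewrite !integral_indic//= !setIT !lebesgue_measure_itv/= !lte_fin p_gt0 p_lt1.
rewrite -!EFinB -!EFinM -EFinD subr0 !divfK ?gt_eqF//; first by rewrite subrK.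
Qed.

HB.instance Definition _ := @Measure_isProbability.Build _ _ R (mu p) mu_setT.

End mu_measure.

(* A probability measure on [0, 1] is taken as one on the line; only its values
   on subsets of [0, 1] are used. *)
Definition S_of (nu : probability R R) : set (R * R) :=
  [set xy | [/\ 0 <= xy.1 <= 1, 0 <= xy.2 <= 1 &
    (nu `[0%R, (1 - xy.2)%R[ <= (xy.1)%:E)%E]].

Definition S_p (p : R) : set (R * R) := S_of (mu p).

End Mu.

(* Main.v *)
Require Import Defs.
From mathcomp Require Import all_boot all_order all_algebra all_fingroup.
From mathcomp Require Import all_classical all_reals all_analysis.
From mathcomp Require Import measurable_realfun ring lra zify.
Import Order.TTheory GRing.Theory Num.Theory.
Import numFieldNormedType.Exports.
Local Open Scope ring_scope.

Set Implicit Arguments.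
Unset Strict Implicit.
Unset Printing Implicit Defensive.

(** Each uniform variable [U_i] encodes two independent pieces of data about the
    vertex [i]. Its type: dominating when [U_i > 1 - p], which has probability
    [p], and isolated when [U_i < 1 - p]. Its insertion time, uniform on (0, 1):
    a dominating vertex of time [a] sits at [1 - p (1 - a)], an isolated one at
    [(1 - p) (1 - a)] (see [position]). The boundary of [S_p] is formed by
    the pairs of positions of opposite types at the same time, so that two
    vertices are joined in [T_{n;S_p}] exactly when the one of larger time is
    dominating ([position_S_p]). This is the rule that defines a threshold graph;
    as the times are exchangeable and independent of the types, the order of
    insertion is a uniform permutation independent of the types. The type of the
    vertex inserted first has no influence.

    The independence and uniformity of the order are obtained without product
    measures or almost sure statements. For each [N], cut the time interval into
    [N] equal slots. The events that each vertex [i] has a prescribed slot and a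
    prescribed type are disjoint boxes, whose probabilities follow from the
    product rule ([uniform_cell]). If the slots are distinct then the graph is
    known ([cell_graph]); summing over the [N ^_ n] injective choices of slots,
    each of which orders the vertices, shows that a graph [G] has probability at
    least [N ^_ n / N ^ n] times its probability for the relabelled threshold
    graph ([set_graph_law_ge]). When [N] grows the ratio tends to 1
    ([ffact_ratio_ge]), so that one law dominates the other at every graph. Both
    have total mass 1, hence they are equal ([eq_law_of_le]). *)

(** * Graphs determined by insertion times and types *)

Lemma eq_graph_of n (r r' : rel 'I_n) :
  (forall i j, i != j -> r i j || r j i = r' i j || r' j i) ->
  graph_of r = graph_of r'.
Proof.
suff sub (r1 r2 : rel 'I_n) :
    (forall i j, i != j -> r1 i j || r1 j i = r2 i j || r2 j i) ->
    edges_of r1 \subset edges_of r2.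
  move=> rr'; apply: val_inj; apply/eqP; rewrite finset.eqEsubset /= !sub// => i j ij.
  by rewrite rr'.
move=> rr'; apply/fintype.subsetP => e; rewrite !inE.
move=> /existsP[i /existsP[j /and3P[ij rij eij]]].
have : r2 i j || r2 j i by rewrite -rr'// rij.
case/orP => r2ij.
  by apply/existsP; exists i; apply/existsP; exists j; rewrite ij r2ij.
apply/existsP; exists j; apply/existsP; exists i.
by rewrite eq_sym ij r2ij (eqP eij) finset.setUC eqxx.
Qed.

Lemma relabel_graph_of n (s : {perm 'I_n}) (r : rel 'I_n) :
  relabel s (graph_of r) = graph_of (fun i j => r (s^-1%g i) (s^-1%g j)).
Proof.
apply: val_inj; apply/setP => e; rewrite /= inE; apply/imsetP/existsP.
  move=> [f]; rewrite inE => /existsP[i /existsP[j /and3P[ij rij /eqP->]]] ->.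
  exists (s i); apply/existsP; exists (s j).
  by rewrite (inj_eq perm_inj) ij !permK rij imsetU1 imset_set1 eqxx.
move=> [i /existsP[j /and3P[ij rij /eqP->]]].
exists [set s^-1%g i; s^-1%g j].
  rewrite inE; apply/existsP; exists (s^-1%g i); apply/existsP; exists (s^-1%g j).
  by rewrite (inj_eq perm_inj) ij rij eqxx.
by rewrite imsetU1 imset_set1 !permKV.
Qed.

(** Every pair is decided by the vertex inserted last: it is joined to the earlier
    one iff its type [c] is dominating. Only the order of the times [t] matters,
    and when two times coincide the vertices are not joined. *)
Definition latecomer_graph n (t : 'I_n -> nat) (c : 'I_n -> bool) : graph n :=
  graph_of (fun i j => c i && (t j < t i)%N).

Lemma eq_latecomer n (t t' : 'I_n -> nat) (c c' : 'I_n -> bool) :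
  (forall i j, (t i < t j)%N = (t' i < t' j)%N) -> c =1 c' ->
  latecomer_graph t c = latecomer_graph t' c'.
Proof. by move=> tt cc; apply: eq_graph_of => i j _; rewrite !tt !cc. Qed.

Lemma relabel_latecomer n (s : {perm 'I_n}) (t : 'I_n -> nat) (c : 'I_n -> bool) :
  relabel s (latecomer_graph t c) =
  latecomer_graph (fun i => t (s^-1%g i)) (fun i => c (s^-1%g i)).
Proof. exact: relabel_graph_of. Qed.

(** A threshold graph on [m.+1] vertices has [m] additions, whereas in
    [T_{n;S_p}] all vertices have types. The type [x.1] is given to the vertex [0]. *)
Definition with_first_type m (x : bool * {ffun 'I_m -> bool}) : {ffun 'I_m.+1 -> bool} :=
  [ffun i => oapp x.2 x.1 (unlift ord0 i)].

Lemma with_first_type_bij m : bijective (@with_first_type m).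
Proof.
exists (fun c : {ffun 'I_m.+1 -> bool} => (c ord0, [ffun k : 'I_m => c (lift ord0 k)])).
  case=> x b; rewrite /with_first_type ffunE unlift_none /=; congr pair.
  by apply/ffunP => k; rewrite !ffunE liftK.
by move=> c; apply/ffunP => i; rewrite ffunE; case: unliftP => [k ->|->] /=; rewrite ?ffunE.
Qed.

(** The first vertex comes after no other, hence its type [x] is arbitrary. *)
Lemma threshold_latecomer m x (b : {ffun 'I_m -> bool}) :
  @threshold_graph m.+1 b = latecomer_graph val (with_first_type (x, b)).
Proof.
apply: eq_graph_of.
suff E (i j : 'I_m.+1) :
    [exists k : 'I_m, [&& b k, i == k.+1 :> nat & (j <= k)%N]] =
    with_first_type (x, b) i && (val j < val i)%N by move=> i j _; rewrite !E.
rewrite ffunE; case: unliftP => [k ->|->] /=; last first.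
  by rewrite ltn0 andbF; apply/existsP => -[k]; rewrite andbF.
apply/existsP/andP => [[l /and3P[bl]]|[bk jk]].
  by rewrite /bump add1n eqSS => /eqP/val_inj ->.
by exists k; rewrite bk /bump add1n eqxx.
Qed.

(** The permutation sends [i] to the number of vertices inserted before [i]. *)
Lemma insertion_rank n (t : 'I_n -> nat) : injective t ->
  exists s : {perm 'I_n}, forall i j, (t i < t j)%N = (s i < s j)%N.
Proof.
move=> t_inj; pose below i := [set j | (t j < t i)%N].
have lt_n i : (#|below i| < n)%N.
  rewrite -[ltnRHS]card_ord -cardsT; apply/proper_card/properP.
  by split; [exact: finset.subsetT | exists i; rewrite ?inE ?ltnn].
pose r i := Ordinal (lt_n i).
have r_lt i j : (t i < t j)%N -> (r i < r j)%N.
  move=> tij; apply/proper_card/properP; split.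
    by apply/fintype.subsetP => k; rewrite !inE => /ltn_trans; apply.
  by exists i; rewrite !inE ?ltnn.
have r_eq i j : (t i < t j)%N = (r i < r j)%N.
  apply/idP/idP; first exact: r_lt.
  have [//|/r_lt ji|/t_inj ->] := ltngtP (t i) (t j); last by rewrite ltnn.
  by move=> ij; have := ltn_trans ij ji; rewrite ltnn.
have r_inj : injective r.
  move=> i j rij; apply: t_inj; case: (ltngtP (t i) (t j)) => //;
    by rewrite r_eq rij ltnn.
by exists (perm r_inj) => i j; rewrite !permE r_eq.
Qed.

Section Law.
Variables (R : realType) (p : R).

Definition type_prob (x : bool) : R := if x then p else 1 - p.

(** The probability of [G] for the relabelled threshold graph. *)
Definition threshold_law m (G : graph m.+1) : R :=
  (m.+1`!%:R)^-1 * \sum_(s : {perm 'I_m.+1}) \sum_(b : {ffun 'I_m -> bool})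
    (relabel s (@threshold_graph m.+1 b) == G)%:R * \prod_k type_prob (b k).

(** Whatever the injective times are, shuffling them uniformly gives a uniform
    insertion order, since they induce the same order as some permutation; and
    permuting types that are independent and identically distributed does not
    change their weight. The type of the first vertex is summed out. *)
Lemma latecomer_perm_sum m (t : 'I_m.+1 -> nat) (G : graph m.+1) : injective t ->
  \sum_(s : {perm 'I_m.+1}) \sum_(c : {ffun 'I_m.+1 -> bool})
    (latecomer_graph (t \o s) c == G)%:R * \prod_i type_prob (c i) =
  m.+1`!%:R * threshold_law G.
Proof.
move=> /insertion_rank[r tr]; rewrite mulrA divff ?mul1r; last first.
  by rewrite pnatr_eq0 -lt0n fact_gt0.
(* With this substitution the time of [s k] becomes the one of rank [k]. *)
rewrite (reindex (fun s : {perm 'I_m.+1} => (s^-1 * r^-1)%g)) /=; last first.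
  exists (fun s : {perm 'I_m.+1} => (r^-1 * s^-1)%g) => s _;
    by rewrite ?invMg ?invgK ?mulgA ?mulgV ?mul1g ?mulgK ?mulgKV ?mulVg ?mul1g.
apply: eq_bigr => s _.
rewrite (reindex (fun c : {ffun 'I_m.+1 -> bool} => [ffun i => c (s^-1%g i)])) /=;
  last first.
  exists (fun c : {ffun 'I_m.+1 -> bool} => [ffun i => c (s i)]) => c _;
    by apply/ffunP => i; rewrite !ffunE ?permK ?permKV.
rewrite (reindex (@with_first_type m)) /=; last exact/onW_bij/with_first_type_bij.
rewrite -(pair_bigA _ (fun x b => (latecomer_graph (t \o (s^-1 * r^-1)%g)
   [ffun i => with_first_type (x, b) (s^-1%g i)] == G)%:R *
   \prod_i type_prob ([ffun i => with_first_type (x, b) (s^-1%g i)] i))) /=.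
have E x (b : {ffun 'I_m -> bool}) :
   (latecomer_graph (t \o (s^-1 * r^-1)%g)
   [ffun i => with_first_type (x, b) (s^-1%g i)] == G)%:R *
   \prod_i type_prob ([ffun i => with_first_type (x, b) (s^-1%g i)] i) =
   type_prob x * ((relabel s (@threshold_graph m.+1 b) == G)%:R * \prod_k type_prob (b k)).
  rewrite (threshold_latecomer x) relabel_latecomer mulrCA; congr (_%:R * _).
    congr (_ == _); apply: eq_latecomer => [i j|i]; last by rewrite ffunE.
    by rewrite /= tr !permM !permKV.
  rewrite (reindex_inj (@perm_inj _ s)) /= big_ord_recl; congr (_ * _).
    by rewrite !ffunE permK unlift_none.
  by apply: eq_bigr => k _; rewrite !ffunE permK liftK.
under eq_bigr do under eq_bigr do rewrite E.
by rewrite big_bool /= /type_prob -!mulr_sumr -mulrDl addrC subrK mul1r.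
Qed.

(** The set of injective [t] is invariant under [t |-> t \o s], so that the sum may
    be averaged over all permutations [s] before [latecomer_perm_sum] is applied
    to each [t]. *)
Lemma latecomer_injective_sum m N (G : graph m.+1) :
  \sum_(t : {ffun 'I_m.+1 -> 'I_N} | injectiveb t) \sum_(c : {ffun 'I_m.+1 -> bool})
    (latecomer_graph (fun i => t i) c == G)%:R * \prod_i type_prob (c i) =
  (N ^_ m.+1)%:R * threshold_law G.
Proof.
pose F (t : 'I_m.+1 -> 'I_N) := \sum_(c : {ffun 'I_m.+1 -> bool})
    (latecomer_graph (fun i => t i) c == G)%:R * \prod_i type_prob (c i).
have fact_neq0 : m.+1`!%:R != 0 :> R by rewrite pnatr_eq0 -lt0n fact_gt0.
apply: (mulfI fact_neq0).
rewrite mulrCA.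
transitivity (\sum_(s : {perm 'I_m.+1})
   \sum_(t : {ffun 'I_m.+1 -> 'I_N} | injectiveb t) F (t \o s)).
  have -> : m.+1`! = #|{perm 'I_m.+1}| by rewrite card_Sn.
  rewrite -sum1_card natr_sum mulr_suml.
  apply: eq_big => [s|s _]; first by rewrite inE.
  rewrite mul1r.
  rewrite (reindex (fun t : {ffun 'I_m.+1 -> 'I_N} => [ffun i => t (s i)])) /=.
    apply: eq_big => [t|t _].
      apply/injectiveP/injectiveP => t_inj i j.
        move=> tij; rewrite -(permKV s i) -(permKV s j); congr (s _).
        by apply: t_inj; rewrite !ffunE !permKV.
      by rewrite !ffunE => /t_inj/perm_inj.
    apply: eq_bigr => c _; congr ((_ == _)%:R * _).
    by apply: eq_latecomer => // i j; rewrite !ffunE.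
  exists (fun t : {ffun 'I_m.+1 -> 'I_N} => [ffun i => t (s^-1%g i)]) => t _;
    by apply/ffunP => i; rewrite !ffunE ?permK ?permKV.
rewrite exchange_big /=.
transitivity (\sum_(t : {ffun 'I_m.+1 -> 'I_N} | injectiveb t)
  m.+1`!%:R * threshold_law G).
  apply: eq_bigr => t /injectiveP t_inj.
  rewrite -(@latecomer_perm_sum m (fun i => t i)) => [//|i j /val_inj /t_inj //].
rewrite sumr_const -[LHS]mulr_natl; congr (_%:R * _).
by have := card_inj_ffuns 'I_m.+1 'I_N; rewrite !card_ord cardsE.
Qed.

Lemma threshold_law_ge0 m (G : graph m.+1) : 0 <= p <= 1 -> 0 <= threshold_law G.
Proof.
move=> /andP[p0 p1]; rewrite mulr_ge0 ?invr_ge0 ?ler0n//.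
apply: sumr_ge0 => s _; apply: sumr_ge0 => b _; apply: mulr_ge0; first exact: ler0n.
by apply: prodr_ge0 => k _; rewrite /type_prob; case: ifP; rewrite ?subr_ge0.
Qed.

End Law.

(** Induction on [n], multiplying by [1 - n / N]; the square leaves enough room to
    absorb the cross terms, and for [n > N] the bound is trivial. *)
Lemma ffact_ratio_ge (R : realType) (n N : nat) : (0 < N)%N ->
  1 - (n ^ 2)%:R / N%:R <= (N ^_ n)%:R / N%:R ^+ n :> R.
Proof.
move=> N_gt0; have N_gt0R : 0 < N%:R :> R by rewrite ltr0n.
have ratio_le1 k : (N ^_ k)%:R / N%:R ^+ k <= 1 :> R.
  rewrite ler_pdivrMr ?exprn_gt0// mul1r -natrX ler_nat.
  elim: k => // k IH; rewrite ffactnSr expnSr leq_mul//; exact: leq_subr.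
elim: n => [|n IH]; first by rewrite mul0r subr0 divr1.
have [nN|Nn] := leqP n N; last first.
  apply: (@le_trans _ _ 0); last by rewrite divr_ge0.
  rewrite subr_le0 ler_pdivlMr// mul1r ler_nat.
  by rewrite (leq_trans (ltnW Nn))// (leq_trans (leqnSn n))// leq_pmulr.
rewrite ffactnSr natrM exprSr -mulf_div natrB// mulrBl divff ?gt_eqF//.
set a := (N ^_ n)%:R / _ in IH *.
rewrite mulrBr mulr1.
have : a * (n%:R / N%:R) <= n%:R / N%:R.
  by rewrite ler_piMl ?divr_ge0// ratio_le1.
have : (n.+1 ^ 2)%:R / N%:R = (n ^ 2)%:R / N%:R + n%:R / N%:R + n.+1%:R / N%:R :> R.
  by rewrite -!mulrDl -!natrD; congr (_%:R / _); lia.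
have : 0 <= n.+1%:R / N%:R :> R by rewrite divr_ge0.
lra.
Qed.

(** * The set S_p in terms of insertion times and types *)

Section MuS.
Variables (R : realType) (p : R).
Local Notation leb := (@lebesgue_measure R).
Local Open Scope classical_set_scope.

Lemma mu_lebesgue (A : set R) : 0 < p < 1 -> measurable A ->
  (mu p A = ((1 - p) / p)%:E * leb (A `&` `]0%R, p[) +
            (p / (1 - p))%:E * leb (A `&` `]p, 1%R[))%E.
Proof.
move=> /andP[p_gt0 p_lt1] mA.
have q_gt0 : 0 < 1 - p by rewrite subr_gt0.
have hl : 0 <= (1 - p) / p by rewrite divr_ge0// ltW.
have hr : 0 <= p / (1 - p) by rewrite divr_ge0// ltW.
rewrite /mu leNgt p_gt0 leNgt p_lt1 /=.
transitivity (\int[leb]_(x in A)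
   (((1 - p) / p)%:E * (\1_(`]0%R, p[%classic : set R) x)%:E +
    (p / (1 - p))%:E * (\1_(`]p, 1%R[%classic : set R) x)%:E))%E.
  apply: eq_integral => x _; rewrite -!EFinM -EFinD; congr (_%:E).
  rewrite /mu_density !indicE !mem_setE !in_itv/=.
  case: ifPn => [/andP[x0 xp]|_].
    by rewrite (lt_gtF xp)/= mulr1 mulr0 addr0.
  by case: ifPn => _; rewrite ?mulr1 !mulr0 ?add0r ?addr0.
have m_indic (a b : R) : measurable_fun A (EFin \o \1_(`]a, b[%classic : set R)).
  by apply/measurable_EFinP; apply: measurable_funTS; exact: measurable_indic.
rewrite ge0_integralD//; first last.
- by apply: (@measurable_funeM _ _ _ A (EFin \o \1_(`]p, 1[%classic : set R))).
- by move=> x _; rewrite -EFinM lee_fin mulr_ge0.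
- by apply: (@measurable_funeM _ _ _ A (EFin \o \1_(`]0, p[%classic : set R))).
- by move=> x _; rewrite -EFinM lee_fin mulr_ge0.
rewrite !ge0_integralZl//; try by [apply: m_indic | rewrite lee_fin | move=> *; rewrite lee_fin].
by rewrite !integral_indic//= ![A `&` _]setIC.
Qed.

Lemma lebesgue_itvoo (a c : R) : (a <= c) -> leb `]a, c[ = (c - a)%:E.
Proof.
move=> ac; rewrite lebesgue_measure_itv/= lte_fin; case: ltP => // ca.
by have -> : a = c by [apply/le_anti; rewrite ac ca]; rewrite subrr.
Qed.

(** This and the next lemma evaluate the threshold that defines [S_mu], with
    [1 - y] on either side of the discontinuity [p] of the density. Written in
    these coordinates, the formulas also hold for the point mass at [p = 1], and
    at [p = 0] in the next lemma. *)
Lemma mu_below_dominating (a : R) : 0 < p <= 1 -> 0 <= a <= 1 ->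
  mu p `[0, p * a[ = ((1 - p) * a)%:E.
Proof.
move=> /andP[p0]; rewrite le_eqVlt => /orP[/eqP -> | p1] /andP[a0 a1].
  rewrite /mu ler10 lexx subrr mul0r mul1r diracE memNset//= in_itv/=.
  by rewrite ltNge a1 andbF.
rewrite mu_lebesgue ?p0//.
have -> : `[0, p * a[ `&` `]0, p[ = `]0, p * a[ :> set R.
  apply/seteqP; split => x /=; rewrite !in_itv/=; first by move=> [/andP[_ ->] /andP[->]].
  move=> /andP[x0 xpa]; rewrite x0 xpa (ltW x0); split => //=.
  by rewrite (lt_le_trans xpa)// ler_piMr// ltW.
have -> : `[0, p * a[ `&` `]p, 1[ = set0 :> set R.
  apply/seteqP; split => // x /=; rewrite !in_itv/= => -[/andP[_ xpa] /andP[px _]].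
  have : p * a <= p by rewrite ler_piMr// ltW.
  lra.
rewrite measure0 mule0 adde0 lebesgue_itvoo ?mulr_ge0 ?(ltW p0)// -EFinM.
by congr EFin; field; lra.
Qed.

Lemma mu_below_isolated (a : R) : 0 <= p < 1 -> 0 <= a < 1 ->
  mu p `[0, 1 - (1 - p) * a[ = (1 - p * a)%:E.
Proof.
move=> /andP[]; rewrite le_eqVlt => /orP[/eqP <- _ | p0 p1] /andP[a0 a1].
  rewrite /mu lexx subr0 mul0r mul1r subr0 diracE mem_set//= in_itv/=.
  by rewrite lexx subr_gt0.
rewrite mu_lebesgue ?p0//.
have q0 : 0 < 1 - p by lra.
have qa : (1 - p) * a < 1 - p by rewrite -[ltRHS]mulr1 ltr_pM2l.
have qa0 : 0 <= (1 - p) * a by rewrite mulr_ge0// ltW.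
have -> : `[0, 1 - (1 - p) * a[ `&` `]0, p[ = `]0, p[ :> set R.
  apply/seteqP; split => x /=; rewrite !in_itv/=; first by move=> [].
  by move=> /andP[x0 xp]; split; apply/andP; split => //; lra.
have -> : `[0, 1 - (1 - p) * a[ `&` `]p, 1[ = `]p, 1 - (1 - p) * a[ :> set R.
  apply/seteqP; split => x /=; rewrite !in_itv/=.
    by move=> [/andP[_ h] /andP[-> _]].
  by move=> /andP[px xa]; split; apply/andP; split => //; lra.
rewrite !lebesgue_itvoo; [|lra|lra].
by rewrite -!EFinM -EFinD; congr EFin; field; lra.
Qed.

(** The point of the unit interval at which a vertex of type [x] and insertion
    time [a] is found. A larger position can only create edges: it increases
    with the time of a dominating vertex and decreases with that of an isolated
    one. *)
Definition position (x : bool) (a : R) : R :=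
  if x then 1 - p * (1 - a) else (1 - p) * (1 - a).

(** By the two formulas for [mu], [(u, position z e)] lies in [S_p] iff [u] is at
    least the position of the opposite type at time [e]. Both orders of the
    coordinates are allowed in the conclusion, which avoids a proof that [S_p] is
    symmetric. Positivity of the probabilities excludes the degenerate type when
    [p] is 0 or 1. *)
Lemma position_S_p (x y : bool) (a c : R) : 0 <= p <= 1 ->
    0 < type_prob p x -> 0 < type_prob p y -> 0 < a < c -> c < 1 ->
  ((position x a, position y c) \in S_p p) ||
  ((position y c, position x a) \in S_p p) = y.
Proof.
move=> p01 x_gt0 y_gt0 /andP[a_gt0 ac] c_lt1.
have pos01 z e : 0 < e < 1 -> 0 <= position z e <= 1.
  move=> e01; have : 0 <= p * (1 - e) <= 1 by nra.
  have : 0 <= (1 - p) * (1 - e) <= 1 by nra.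
  by rewrite /position; case: z; lra.
have in_S z e u : 0 < type_prob p z -> 0 < e < 1 -> 0 <= u <= 1 ->
    ((u, position z e) \in S_p p) = (position (~~ z) e <= u).
  move=> z_gt0 e01 u01.
  have nuE : mu p `[0%R, (1 - position z e)%R[ = (position (~~ z) e)%:E.
    move: z_gt0; rewrite /position /type_prob; case: z => /= z_gt0.
      rewrite opprB addrC subrK mu_below_dominating//; lra.
    by rewrite mu_below_isolated//; lra.
  apply/idP/idP => [|le_u].
    by rewrite inE => -[_ _] /=; rewrite nuE lee_fin.
  by rewrite inE; split => /=; [|exact: pos01|rewrite nuE lee_fin].
rewrite !in_S ?pos01//; try lra.
(* Either both orders of the coordinates give an element of [S_p], or neither. *)
move: x_gt0 y_gt0; rewrite /type_prob /position; case: x; case: y => /= x0 y0.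
- by apply/orP; left; nra.
- by apply/negbTE; rewrite negb_or -!ltNge; nra.
- by apply/orP; left; nra.
- by apply/negbTE; rewrite negb_or -!ltNge; nra.
Qed.

(** The positions of a vertex of type [x] whose time is in the open slot
    [(j / N, (j + 1) / N)]. The position of an isolated vertex decreases with its
    time, whence the exchange of the bounds. *)
Definition cell N (j : 'I_N) (x : bool) : set R :=
  if x then `]position x (j%:R / N%:R), position x (j.+1%:R / N%:R)[
  else `]position x (j.+1%:R / N%:R), position x (j%:R / N%:R)[.

Lemma measurable_cell N (j : 'I_N) x : measurable (cell j x).
Proof. by rewrite /cell; case: x. Qed.

(** A cell of a type of probability 0 is empty, which is why membership gives
    [0 < type_prob p x]. *)
Lemma cell_position N (j : 'I_N) x u : 0 <= p <= 1 -> cell j x u ->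
  0 < type_prob p x /\ exists2 a, j%:R < N%:R * a < j.+1%:R & u = position x a.
Proof.
move=> p01; have N0 : 0 < N%:R :> R by rewrite ltr0n (leq_ltn_trans _ (ltn_ord j)).
have jN : j.+1%:R / N%:R = j%:R / N%:R + N%:R^-1 :> R.
  by rewrite -addn1 natrD mulrDl mul1r.
have iN0 : 0 < N%:R^-1 :> R by rewrite invr_gt0.
have NV : N%:R * N%:R^-1 = 1 :> R by rewrite divff ?gt_eqF.
have jE : j%:R = N%:R * (j%:R / N%:R) :> R by rewrite mulrCA NV mulr1.
have j1E : j.+1%:R = N%:R * (j.+1%:R / N%:R) :> R by rewrite mulrCA NV mulr1.
rewrite /cell /type_prob /position; case: x => /=; rewrite in_itv/= jN => /andP[lu ul].
  have p0 : 0 < p by nra.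
  split => //; exists (1 - (1 - u) / p); last by field; lra.
  rewrite j1E jN {1}jE !ltr_pM2l//; apply/andP.
  rewrite -(ltr_pM2l p0) -[X in _ /\ is_true X](ltr_pM2l p0).
  have -> : p * (1 - (1 - u) / p) = p - (1 - u) by field; lra.
  by split; nra.
have p1 : 0 < 1 - p by nra.
split => //; exists (1 - u / (1 - p)); last by field; lra.
rewrite j1E jN {1}jE !ltr_pM2l//; apply/andP.
rewrite -(ltr_pM2l p1) -[X in _ /\ is_true X](ltr_pM2l p1).
have -> : (1 - p) * (1 - u / (1 - p)) = (1 - p) - u by field; lra.
by split; nra.
Qed.

Lemma cell_inj N (j k : 'I_N) x y u : 0 <= p <= 1 ->
  cell j x u -> cell k y u -> (j, x) = (k, y).
Proof.
move=> p01 /(cell_position p01)[x0 [a ja ->]] /(cell_position p01)[y0 [c kc ac]].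
have N0 : 0 < N%:R :> R by rewrite ltr0n (leq_ltn_trans _ (ltn_ord j)).
have bnd (i : 'I_N) (e : R) : i%:R < N%:R * e < i.+1%:R -> 0 < e < 1.
  move=> /andP[ie ei]; apply/andP; split; rewrite -(ltr_pM2l N0) ?mulr0 ?mulr1.
    exact: le_lt_trans ie.
  by rewrite (lt_le_trans ei)// ler_nat.
have a01 := bnd _ _ ja; have c01 := bnd _ _ kc.
have xy : x = y.
  by move: x0 y0 ac; rewrite /type_prob /position; case: x; case: y => // x0 y0; nra.
rewrite -{y}xy in y0 ac *; congr pair; apply: val_inj.
have aE : a = c.
  move: x0 ac; rewrite /type_prob /position; case: x {y0} => x0 ac.
    have : p * a = p * c by lra.
    by move/mulfI; apply; rewrite gt_eqF.
  have : (1 - p) * a = (1 - p) * c by lra.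
  by move/mulfI; apply; rewrite gt_eqF.
move: ja kc => /andP[ja aj] /andP[kc ck]; rewrite -aE in kc ck.
have := lt_trans ja ck; have := lt_trans kc aj.
by rewrite !ltr_nat !ltnS => kj jk; apply/eqP; rewrite eqn_leq jk.
Qed.

(** Distinct slots force distinct times in the same order. *)
Lemma cell_graph n N (t : 'I_n -> 'I_N) (c : 'I_n -> bool) (u : 'I_n -> R) :
  0 <= p <= 1 -> injective t -> (forall i, cell (t i) (c i) (u i)) ->
  graph_of_set (S_p p) u = latecomer_graph t c.
Proof.
move=> p01 t_inj in_cell; apply: eq_graph_of.
suff H i j : (t i < t j)%N ->
    ((u i, u j) \in S_p p) || ((u j, u i) \in S_p p) = c j.
  move=> i j ij; case: (ltngtP (t i) (t j)) => tij /=.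
  - by rewrite H// andbF andbT.
  - by rewrite orbC H// andbT andbF orbF.
  - by move/val_inj/t_inj : tij ij => ->; rewrite eqxx.
move=> tij.
have [x0 [a /andP[ia ai] ->]] := cell_position p01 (in_cell i).
have [y0 [e /andP[je ej] ->]] := cell_position p01 (in_cell j).
have N0 : 0 < N%:R :> R by rewrite ltr0n (leq_ltn_trans _ (ltn_ord (t i))).
apply: position_S_p => //.
  apply/andP; split; first by rewrite -(ltr_pM2l N0) mulr0 (le_lt_trans _ ia).
  by rewrite -(ltr_pM2l N0) (lt_le_trans ai)// (le_trans _ (ltW je))// ler_nat.
by rewrite -(ltr_pM2l N0) mulr1 (lt_le_trans ej)// ler_nat.
Qed.

Lemma uniform_cell N (j : 'I_N) x : 0 <= p <= 1 ->
  uniform_prob (@ltr01 R) (cell j x) = (type_prob p x / N%:R)%:E.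
Proof.
move=> p01.
have N0 : 0 < N%:R :> R by rewrite ltr0n (leq_ltn_trans _ (ltn_ord j)).
have jN : j.+1%:R / N%:R = j%:R / N%:R + N%:R^-1 :> R.
  by rewrite -addn1 natrD mulrDl mul1r.
have iN0 : 0 < N%:R^-1 :> R by rewrite invr_gt0.
have j0 : 0 <= j%:R / N%:R :> R by rewrite divr_ge0.
have j1 : j.+1%:R / N%:R <= 1 :> R by rewrite ler_pdivrMr// mul1r ler_nat.
have unif (a c : R) : 0 <= a -> a <= c -> c <= 1 ->
    uniform_prob (@ltr01 R) `]a, c[ = (c - a)%:E.
  move=> a0 ac c1; rewrite /uniform_prob.
  rewrite (eq_integral (cst 1%E)); last first.
    move=> x'; rewrite inE/= in_itv/= => /andP[ax xc]; rewrite /uniform_pdf.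
    by rewrite subr0 invr1 ifT//; lra.
  by rewrite integral_cst//= mul1e lebesgue_itvoo.
rewrite /cell /type_prob /position jN; case: x;
  by rewrite unif; [congr EFin; ring|nra|nra|nra].
Qed.

End MuS.

(** * Laws of random variables with finitely many values *)

Section FiniteLaws.
Local Open Scope classical_set_scope.
Local Open Scope ereal_scope.

Lemma measure_bigcup_fintype d (T : measurableType d) (R : realType)
    (nu : {measure set T -> \bar R}) (I : finType) (Q : pred I) (F : I -> set T) :
  (forall i, Q i -> measurable (F i)) -> trivIset [set` Q] F ->
  measurable (\bigcup_(i in [set` Q]) F i) /\
  nu (\bigcup_(i in [set` Q]) F i) = \sum_(i | Q i) nu (F i).
Proof.
move=> mF tF; split; first exact: fin_bigcup_measurable.
rewrite measure_fin_bigcup//.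
have -> : [set` Q] = [set` enum Q] by apply/seteqP; split => i /=; rewrite mem_enum.
by rewrite -fsbig_seq ?enum_uniq// big_enum.
Qed.

Lemma finite_valued_law d (T : measurableType d) (R : realType)
    (P : {measure set T -> \bar R}) (F : finType) (f : T -> F) :
  (forall x, measurable (f @^-1` [set x])) ->
  forall B : set F, measurable (f @^-1` B) /\
    P (f @^-1` B) = \sum_(x | x \in B) P (f @^-1` [set x]).
Proof.
move=> mf B.
have -> : f @^-1` B = \bigcup_(x in [set` (fun x => x \in B)]) f @^-1` [set x].
  apply/seteqP; split => w /=; first by move=> Bw; exists (f w) => //=; rewrite /= mem_set.
  by case=> x /set_mem Bx /= ->.
apply: measure_bigcup_fintype => [x _|x y _ _ [w [/= -> ->]]]//.
Qed.

(** The inequality passes to all events by summation; for an event and its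
    complement, whose probabilities add up to 1, it forces equality. *)
Lemma eq_law_of_le d1 (T1 : measurableType d1) d2 (T2 : measurableType d2)
    (R : realType) (P1 : probability T1 R) (P2 : probability T2 R) (F : finType)
    (X : T1 -> F) (Y : T2 -> F) :
  (forall x, measurable (X @^-1` [set x])) ->
  (forall x, measurable (Y @^-1` [set x])) ->
  (forall x, P1 (X @^-1` [set x]) <= P2 (Y @^-1` [set x])) ->
  forall B : set F, P1 (X @^-1` B) = P2 (Y @^-1` B).
Proof.
move=> mX mY XY B.
have le_law (C : set F) : P1 (X @^-1` C) <= P2 (Y @^-1` C).
  rewrite (finite_valued_law P1 mX C).2 (finite_valued_law P2 mY C).2.
  by apply: lee_sum => x _; exact: XY.
have [mXB _] := finite_valued_law P1 mX B.
have [mYB _] := finite_valued_law P2 mY B.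
apply/eqP; rewrite eq_le le_law /=.
have := le_law (~` B).
rewrite -!preimage_setC !probability_setC//.
rewrite -(fineK (fin_num_measure P1 _ mXB)) -(fineK (fin_num_measure P2 _ mYB)).
by rewrite -!EFinB !lee_fin lerD2l lerN2.
Qed.

End FiniteLaws.

(** * The law of the relabelled threshold graph *)

Section ThresholdSide.
Variables (R : realType) (p : R) (m : nat).
Variables (d : measure_display) (T : measurableType d) (P : probability T R).
Variables (b : 'I_m -> {RV P >-> bool}) (s : {RV P >-> {perm 'I_m.+1}}).
Hypotheses (p01 : 0 <= p <= 1) (hb : @threshold_additions d T R P p m.+1 b).
Hypotheses (hs : uniform_perm s) (hsb : independent_of_family s b).
Local Open Scope classical_set_scope.

Let Z (w : T) : {perm 'I_m.+1} * {ffun 'I_m -> bool} := (s w, [ffun k => b k w]).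

Let Z_preimage z :
  Z @^-1` [set z] = s @^-1` [set z.1] `&` \bigcap_k (b k @^-1` [set z.2 k]).
Proof.
case: z => t x; apply/seteqP; split => w /=.
  by move=> [<- <-]; split => // k _ /=; rewrite ffunE.
by move=> [<- bx]; congr pair; apply/ffunP => k; rewrite ffunE (bx k).
Qed.

Let measurable_Z z : measurable (Z @^-1` [set z]).
Proof.
rewrite Z_preimage; apply: measurableI; first exact: measurable_funPTI.
by apply: fin_bigcap_measurable => // k _; exact: measurable_funPTI.
Qed.

Let Z_law z : P (Z @^-1` [set z]) =
  ((m.+1`!%:R)^-1 * \prod_k type_prob p (z.2 k))%:E.
Proof.
rewrite Z_preimage hsb// hs EFinM; congr (_ * _)%E.
have -> : \bigcap_k (b k @^-1` [set z.2 k]) =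
    \bigcap_(k in [set` [set: 'I_m]%SET]) (b k @^-1` [set z.2 k]).
  by congr (bigcap _ _); apply/seteqP; split => k //=; rewrite inE.
rewrite hb.1// -prodEFin; apply: eq_big => [k|k _]; first by rewrite inE.
have := hb.2 k [set z.2 k]; rewrite /distribution /pushforward => -> //.
rewrite bernoulli_probE// !diracE /type_prob; case: (z.2 k).
  by rewrite mem_set// memNset//= mule1 mule0 adde0.
by rewrite memNset//= mem_set//= mule1 mule0 add0e.
Qed.

Lemma relabelled_threshold_law (G : graph m.+1) :
  measurable (@relabelled_threshold_graph d T R P m.+1 b s @^-1` [set G]) /\
  P (@relabelled_threshold_graph d T R P m.+1 b s @^-1` [set G]) =
    (threshold_law p G)%:E.
Proof.
pose f (z : {perm 'I_m.+1} * {ffun 'I_m -> bool}) :=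
  relabel z.1 (@threshold_graph m.+1 z.2).
have -> : @relabelled_threshold_graph d T R P m.+1 b s @^-1` [set G] =
    Z @^-1` [set z | f z = G].
  apply/seteqP; split => w /=; rewrite /relabelled_threshold_graph /f /= => <-;
    congr (relabel _ (graph_of _)); apply/funext => i; apply/funext => j;
    by apply: eq_existsb => k; rewrite ffunE.
have [mZ ->] := finite_valued_law P measurable_Z [set z | f z = G]; split => //.
rewrite (eq_bigr _ (fun z _ => Z_law z)) sumEFin /threshold_law; congr EFin.
rewrite -mulr_sumr pair_bigA big_mkcond /=; congr (_ * _).
apply: eq_bigr => z _; rewrite /f; case: eqP => [fz|fz].
  by rewrite mem_set// mul1r.
by rewrite memNset// mul0r.
Qed.

End ThresholdSide.

(** * The law of the random graph of the set S_p *)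

Section SetSide.
Variables (R : realType) (p : R) (m : nat).
Variables (d : measure_display) (T : measurableType d) (P : probability T R).
Variables (U : 'I_m.+1 -> {RV P >-> R}).
Hypotheses (p01 : 0 <= p <= 1) (hU : iid_uniform U).
Local Open Scope classical_set_scope.

(** The threshold that defines [S_nu] is a nonincreasing function of [y], hence
    measurable. *)
Lemma measurable_S_of (nu : probability R R) (X Y : {RV P >-> R}) :
  measurable [set w | (X w, Y w) \in S_of nu].
Proof.
pose g (y : R) := fine (nu `[0%R, (1 - y)%R[).
have mg : measurable_fun setT g.
  apply: nonincreasing_measurable => // x y xy.
  apply: fine_le; rewrite ?fin_num_measure//.
  apply: le_measure; rewrite ?inE//; apply: subset_itvl; rewrite bnd_simp; lra.
have -> : [set w | (X w, Y w) \in S_of nu] =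
    [set w | [&& 0 <= X w, X w <= 1, 0 <= Y w, Y w <= 1 & g (Y w) <= X w]].
  apply/seteqP; split => w /=; rewrite inE /S_of /=.
    move=> [/andP[-> ->] /andP[-> ->]] /=.
    by rewrite -(fineK (fin_num_measure nu _ _)) ?lee_fin.
  move=> /and5P[x0 x1 y0 y1 gyx]; split; rewrite ?x0 ?y0//.
  by rewrite -(fineK (fin_num_measure nu _ _)) ?lee_fin.
rewrite -[X in measurable X]setTI.
suff : measurable_fun setT
    (fun w => [&& 0 <= X w, X w <= 1, 0 <= Y w, Y w <= 1 & g (Y w) <= X w]).
  by move=> /(_ measurableT [set true]); apply.
do 4! (apply: measurable_and; first exact: measurable_fun_ler).
by apply: measurable_fun_ler => //; exact: measurableT_comp.
Qed.

Lemma measurable_graph_of_set (nu : probability R R) (G : graph m.+1) :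
  measurable (random_graph_of_set (S_of nu) U @^-1` [set G]).
Proof.
pose Z w : {ffun 'I_m.+1 * 'I_m.+1 -> bool} :=
  [ffun ij => (U ij.1 w, U ij.2 w) \in S_of nu].
have mZ z : measurable (Z @^-1` [set z]).
  have -> : Z @^-1` [set z] =
      \bigcap_ij [set w | ((U ij.1 w, U ij.2 w) \in S_of nu) = z ij].
    apply/seteqP; split => w /=; first by move=> <- ij _; rewrite ffunE.
    by move=> Zz; apply/ffunP => ij; rewrite ffunE Zz.
  apply: fin_bigcap_measurable => // ij _.
  have mS := measurable_S_of nu (U ij.1) (U ij.2).
  case: (z ij) => //.
  have -> : [set w | ((U ij.1 w, U ij.2 w) \in S_of nu) = false] =
      ~` [set w | (U ij.1 w, U ij.2 w) \in S_of nu].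
    by apply/seteqP; split => w /= => [->//|/negP/negbTE].
  exact: measurableC.
have -> : random_graph_of_set (S_of nu) U @^-1` [set G] =
    Z @^-1` [set z : {ffun 'I_m.+1 * 'I_m.+1 -> bool} | graph_of (fun i j => z (i, j)) = G].
  apply/seteqP; split => w /=; rewrite /random_graph_of_set /graph_of_set => <-;
    by congr graph_of; apply/funext => i; apply/funext => j; rewrite ffunE.
exact: (finite_valued_law P mZ _).1.
Qed.

Let box N (z : {ffun 'I_m.+1 -> 'I_N} * {ffun 'I_m.+1 -> bool}) : set T :=
  \bigcap_i (U i @^-1` cell p (z.1 i) (z.2 i)).

(** Ties between slots are discarded, which is the only loss in this bound. *)
Lemma set_graph_law_ge N (G : graph m.+1) : (0 < N)%N ->
  (((N ^_ m.+1)%:R / N%:R ^+ m.+1 * threshold_law p G)%:E <=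
    P (random_graph_of_set (S_p p) U @^-1` [set G]))%E.
Proof.
move=> N0.
have N0R : N%:R != 0 :> R by rewrite pnatr_eq0 -lt0n.
pose Q (z : {ffun 'I_m.+1 -> 'I_N} * {ffun 'I_m.+1 -> bool}) :=
  injectiveb z.1 && (latecomer_graph (fun i => z.1 i) z.2 == G).
have mbox (z : {ffun 'I_m.+1 -> 'I_N} * {ffun 'I_m.+1 -> bool}) : measurable (box z).
  apply: fin_bigcap_measurable => // i _; apply: measurable_funPTI.
  exact: measurable_cell.
have Pbox (z : {ffun 'I_m.+1 -> 'I_N} * {ffun 'I_m.+1 -> bool}) :
    P (box z) = ((\prod_i type_prob p (z.2 i)) / N%:R ^+ m.+1)%:E.
  have -> : box z = \bigcap_(i in [set` [set: 'I_m.+1]%SET])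
      (U i @^-1` cell p (z.1 i) (z.2 i)).
    by congr (bigcap _ _); apply/seteqP; split => k //=; rewrite inE.
  rewrite hU.1; last by move=> i; exact: measurable_cell.
  rewrite -[m.+1 in X in (_ / X)%:E]card_ord -prodr_const -prodf_div -prodEFin.
  apply: eq_big => [k|k _]; first by rewrite inE.
  rewrite -(uniform_cell (z.1 k) _ p01) -(hU.2 k)//; exact: measurable_cell.
have tbox : trivIset [set` Q] (@box N).
  move=> [t c] [t' c'] _ _ [w [/= wz wz']].
  have E i := cell_inj p01 (wz i I) (wz' i I).
  by congr pair; apply/ffunP => i; have [] := E i.
have [mU PU] := measure_bigcup_fintype P (fun z _ => mbox z) tbox.
have -> : ((N ^_ m.+1)%:R / N%:R ^+ m.+1 * threshold_law p G)%:E =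
    P (\bigcup_(z in [set` Q]) box z).
  rewrite PU (eq_bigr _ (fun z _ => Pbox z)) sumEFin; congr EFin.
  rewrite mulrAC -latecomer_injective_sum mulr_suml.
  rewrite -(pair_big_dep (fun t : {ffun 'I_m.+1 -> 'I_N} => injectiveb t)
    (fun t (c : {ffun 'I_m.+1 -> bool}) => latecomer_graph (fun i => t i) c == G)
    (fun _ c => (\prod_i type_prob p (c i)) / N%:R ^+ m.+1)) /=.
  apply: eq_bigr => t _; rewrite mulr_suml [RHS]big_mkcond /=.
  by apply: eq_bigr => c _; case: eqP => _; rewrite ?mul1r ?mul0r.
apply: le_measure; rewrite ?inE//; first exact: measurable_graph_of_set.
move=> w [[t c] /andP[/= /injectiveP t_inj /eqP <-] wz] /=.
by apply: cell_graph => // i; exact: wz.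
Qed.

End SetSide.

(** * Equality of the two laws *)

Theorem corollary6p5 (R : realType) (p : R) (n : nat)
  (hp : 0 <= p <= 1) (hn : (1 <= n)%N)
  (d1 : measure_display) (T1 : measurableType d1) (P1 : probability T1 R)
  (b : 'I_n.-1 -> {RV P1 >-> bool}) (s : {RV P1 >-> {perm 'I_n}})
  (hb : threshold_additions p b)
  (hs : uniform_perm s) (hsb : independent_of_family s b)
  (d2 : measure_display) (T2 : measurableType d2) (P2 : probability T2 R)
  (U : 'I_n -> {RV P2 >-> R}) (hU : iid_uniform U) :
  eq_in_distribution P1 P2
    (relabelled_threshold_graph b s) (random_graph_of_set (S_p p) U).
Proof.
case: n hn b s hb hs hsb U hU => // m _ b s hb hs hsb U hU.
have mX G := (relabelled_threshold_law hp hb hs hsb G).1.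
have mY G : measurable (random_graph_of_set (S_p p) U @^-1` [set G])%classic.
  exact: measurable_graph_of_set.
split.
- by move=> _ A _; rewrite setTI; exact: (finite_valued_law P1 mX A).1.
- by move=> _ A _; rewrite setTI; exact: (finite_valued_law P2 mY A).1.
move=> A _; apply: eq_law_of_le => // G.
rewrite (relabelled_threshold_law hp hb hs hsb G).2.
set q := threshold_law p G.
have := fun N => @set_graph_law_ge R p m d2 T2 P2 U hp hU N G.
rewrite -(fineK (fin_num_measure P2 _ (mY G))) lee_fin; set y := fine _ => ge_y.
have q0 : 0 <= q by exact: threshold_law_ge0.
rewrite leNgt; apply/negP => yq.
(* Any [N] with [n ^ 2 * q / N < q - y] contradicts the lower bound for [N]. *)
pose N := (Num.bound ((m.+1 ^ 2)%:R * q / (q - y))).+1.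
have := ge_y N isT; rewrite lee_fin leNgt => /negP; apply.
have N0 : 0 < N%:R :> R by rewrite ltr0n.
apply: (@lt_le_trans _ _ ((1 - (m.+1 ^ 2)%:R / N%:R) * q)); last first.
  by rewrite ler_wpM2r// ffact_ratio_ge.
suff : (m.+1 ^ 2)%:R * q / N%:R < q - y by lra.
have : (m.+1 ^ 2)%:R * q / (q - y) < N%:R.
  rewrite (lt_trans (archi_boundP _)) ?ltr_nat//.
  by apply: divr_ge0; [exact: mulr_ge0|rewrite subr_ge0 ltW].
by rewrite !ltr_pdivrMr ?subr_gt0// [ltRHS]mulrC.
Qed.
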